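(* Let $(X,d)$ be a compact, doubling and uniformly perfect metric space, let $L\ge2$, and suppose that the critical exponent $Q_N$ of the combinatorial modulus is positive. Then (for fixed parameters $\kappa,b,\lambda$ of the coverings) the sequence of moduli $\{M_{Q_N,k}(L)\}_{k\ge1}$ admits a positive lower bound, which depends only on $L$ and the doubling constant of $X$.
   Context: Doubling with constant $K_D\geq 1$: every ball can be covered by at most $K_D$ balls of half the radius. Uniformly perfect: there is $K_P>1$ with $B(x,r)\setminus B(x,K_P^{-1}r)\ne\emptyset$ for all $x$ and $0<r\le\mathrm{diam}\,X$. $B(x,r)$ is the open ball. Coverings. Fix $\kappa>1$, $b>1$ and $\lambda\ge32$. For each $k\ge1$, $\mathcal U_k$ is a finite covering of $X$ such that each $B\in\mathcal U_k$ has a chosen center $x_B\in X$ with $B(x_B,\kappa^{-1}b^{-k})\subset B\subset B(x_B,\kappa b^{-k})$, and the balls $B(x_B,\kappa^{-1}b^{-k})$, $B\in\mathcal U_k$, are pairwise disjoint. $\mathcal U=\bigsqcup_k\mathcal U_k$, $|B|=k$ if $B\in\mathcal U_k$, and $\mu\cdot B:=B(x_B,\mu\kappa b^{-k})$ for $\mu>0$. $G_k$ is the graph with vertex set $\mathcal U_k$ and an edge between distinct $B,B'$ whenever $\lambda\cdot B\cap\lambda\cdot B'\ne\emptyset$. Combinatorial modulus. For a family $\Gamma$ of paths (viewed as sets of vertices) in a graph $G$ with vertex set $V$ and $p>0$, $\mathrm{Mod}_p(\Gamma,G)=\inf_\rho\sum_{v\in V}\rho(v)^p$, over all $\rho:V\to[0,\infty)$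 with $\sum_{v\in\gamma}\rho(v)\ge1$ for every $\gamma\in\Gamma$. For $L>1$, $B\in\mathcal U$, $k\ge1$, $\Gamma_{k,L}(B)$ is the family of paths $\{B_i\}_{i=1}^N$ of $G_{|B|+k}$ such that the center of $B_1$ belongs to $B$ and the center of $B_N$ belongs to $X\setminus L\cdot B$. $M_{p,k}(L)=\sup_{B\in\mathcal U}\mathrm{Mod}_p(\Gamma_{k,L}(B),G_{|B|+k})$, and $Q_N=\inf\{p>0:\liminf_{k}M_{p,k}(2)=0\}$ (the same value is obtained with any $L>1$ in place of $2$). *)

(* Defs.v *)
From HB Require Import structures.
From mathcomp Require Import all_boot all_order all_algebra.
From mathcomp Require Import all_classical all_reals all_analysis.

Set Implicit Arguments.
Unset Strict Implicit.
Unset Printing Implicit Defensive.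

Import Order.TTheory GRing.Theory Num.Theory.

Local Open Scope classical_set_scope.
Local Open Scope ring_scope.

Section MetricNotions.
Context {R : realType}.

Definition doubling (X : metricType R) (KD : R) : Prop :=
  forall (x : X) (r : R), 0 < r ->
    exists2 s : seq X, (size s)%:R <= KD &
      ball x r `<=` \bigcup_(y in [set` s]) ball y (r / 2).

Definition diam (X : metricType R) : \bar R :=
  ereal_sup [set d | exists x y : X, d = (mdist x y)%:E].

Definition uniformly_perfect (X : metricType R) : Prop :=
  exists2 KP : R, 1 < KP &
    forall (x : X) (r : R), 0 < r -> (r%:E <= diam X)%E ->
      ball x r `\` ball x (KP^-1 * r) !=set0.

End MetricNotions.

(* The modulus only involves the vertex set V of the graph. Its value is an
   extended real, the infimum being +oo when no weight is admissible. *)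
Section Modulus.
Context {R : realType} {V : finType}.

Definition admissible (Gamma : set {set V}) (rho : V -> R) : Prop :=
  (forall v, 0 <= rho v) /\
  (forall g : {set V}, Gamma g -> 1 <= \sum_(v in g) rho v).

Definition modulus (p : R) (Gamma : set {set V}) : \bar R :=
  ereal_inf [set (\sum_(v : V) rho v `^ p)%:E | rho in admissible Gamma].

End Modulus.

(* The elements of the k-th covering are indexed, without repetition, by the
   finite type [cell_index k]; nothing is required at level 0. *)
Record coverings (R : realType) (X : metricType R) (kappa b : R) := Coverings {
  cell_index :> nat -> finType;
  cell : forall k, cell_index k -> set X;
  center : forall k, cell_index k -> X;
  cell_inj : forall k, (0 < k)%N -> injective (@cell k);
  cell_cover : forall k, (0 < k)%N ->
    \bigcup_(B in [set: cell_index k]) cell B = [set: X];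
  cell_inner : forall k (B : cell_index k), (0 < k)%N ->
    ball (center B) (kappa^-1 * b ^- k) `<=` cell B;
  cell_outer : forall k (B : cell_index k), (0 < k)%N ->
    cell B `<=` ball (center B) (kappa * b ^- k);
  cell_disjoint : forall k (B B' : cell_index k), (0 < k)%N -> B != B' ->
    ball (center B) (kappa^-1 * b ^- k) `&`
    ball (center B') (kappa^-1 * b ^- k) = set0
}.

Section CombinatorialModulus.
Context {R : realType} {X : metricType R} {kappa b : R}.
Variables (U : coverings X kappa b) (lambda : R).

Definition dilate (mu : R) (k : nat) (B : U k) : set X :=
  ball (center B) (mu * kappa * b ^- k).

Definition edge (k : nat) : rel (U k) := fun B B' =>
  (B != B') && `[< dilate lambda B `&` dilate lambda B' !=set0 >].

Definition crossing_paths (L : R) (n : nat) (B : U n) (k : nat) :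
    set {set U (n + k)%N} :=
  [set g | exists (B1 : U (n + k)%N) (s : seq (U (n + k)%N)),
    [/\ path (@edge (n + k)%N) B1 s,
        cell B (center B1),
        (~` dilate L B) (center (last B1 s)) &
        g = [set v in B1 :: s]%SET]].
Arguments crossing_paths L {n} B k _.

Definition sup_modulus (p : R) (k : nat) (L : R) : \bar R :=
  ereal_sup [set m | exists (n : nat) (B : U n),
    (0 < n)%N /\ m = modulus p (crossing_paths L B k)].

Definition critical_exponent : \bar R :=
  ereal_inf [set p%:E | p in
    [set p : R | 0 < p /\ limn_einf (fun k => sup_modulus p k 2) = 0%E]].

End CombinatorialModulus.

Arguments crossing_paths {R X kappa b} U lambda L {n} B k _.

(* Main.v *)
Require Import Defs.
From mathcomp Require Import all_boot all_order all_algebra.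
From mathcomp Require Import all_classical all_reals all_analysis.
From mathcomp Require Import ring lra.

(* Write r = kappa b^-n for a cell B of level n.  Given weights that are
   admissible for the paths of relative depth k crossing from B out of L B, and
   weights for slightly larger path families at relative depth l, one obtains
   weights at depth j + k + l: a path of small cells is shadowed by the path of
   the cells of level n + j + k containing its centers, and the product of the
   two weights is summed over the shadow.  The integer j is a fixed margin
   absorbing the error made in replacing points by centers.  Doubling bounds
   all multiplicities, so the p-energies multiply up to a factor A(p) which is
   independent of k.  Iterating, if the modulus at a single depth k is bounded
   by theta with A(p) theta < 1, then liminf_m M_{p,m}(2) = 0, so Q_N <= p.

   With constant weights of order b^-k at one large depth k this bounds Q_N by
   a constant P.  If M_{Q_N,k}(L) were less than 1 / (6 A(P)), the same would
   hold, up to a factor 3, for some exponent p < Q_N, because near-minimal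
   weights can be supported on a number of cells independent of B.  This would
   give Q_N <= p. *)

Set Implicit Arguments.
Unset Strict Implicit.
Unset Printing Implicit Defensive.

Import Order.TTheory GRing.Theory Num.Theory.
Local Open Scope classical_set_scope.
Local Open Scope ring_scope.

(** * Power sums, paths in graphs, and counting in doubling spaces *)

Section Preliminaries.
Context {R : realType}.
Implicit Types (p : R).

Lemma small_exprn (x a : R) : 0 <= x < 1 -> 0 <= a ->
  exists2 m : nat, (0 < m)%N & a * x ^+ m < 1.
Proof.
move=> /andP[x0 x1] a0.
have xn : `|x| < 1 by rewrite ger0_norm.
have a1 : 0 < (a + 1)^-1 by rewrite invr_gt0; lra.
have /cvgrPdist_lt/(_ _ a1)[m _ hm] := cvg_expr xn.
exists m.+1 => //; have /= := hm m.+1 (leqnSn m).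
rewrite sub0r normrN ger0_norm ?exprn_ge0// => h.
have h' : (a + 1) * x ^+ m.+1 < 1 by rewrite mulrC -ltr_pdivlMr ?div1r//; lra.
by apply: le_lt_trans h'; rewrite ler_wpM2r ?exprn_ge0//; lra.
Qed.

(** The sum is at most [N] times its largest term. This crude bound, unlike convexity, also covers
    [p < 1]. *)
Lemma powR_sum_le (I : finType) (P : pred I) (a : I -> R) (N p : R) : 0 < p ->
  (forall i, 0 <= a i) -> #|P|%:R <= N ->
  (\sum_(i | P i) a i) `^ p <= N `^ p * \sum_(i | P i) a i `^ p.
Proof.
move=> p0 a0 cN.
case: (pickP P) => [i0 Pi0|P0]; last first.
  rewrite !big_pred0// powR0 ?gt_eqF// mulr0//.
have N0 : 0 <= N by exact: le_trans cN.
case: (@arg_maxP _ _ _ i0 P a Pi0) => i Pi amax.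
have sumN : \sum_(i | P i) a i <= N * a i.
  apply: (@le_trans _ _ (\sum_(j | P j) a i)); first exact: ler_sum.
  by rewrite sumr_const -mulr_natl ler_wpM2r.
apply: (@le_trans _ _ ((N * a i) `^ p)).
  by rewrite ge0_ler_powR ?nnegrE ?(ltW p0) ?mulr_ge0 ?sumr_ge0.
rewrite powRM// ler_wpM2l ?powR_ge0//.
by rewrite (bigD1 i)//= lerDl sumr_ge0// => *; exact: powR_ge0.
Qed.

(** Stop at the first vertex satisfying [P]. When [P] means being far away, the truncated path
    overshoots by at most one edge. *)
Lemma path_first_exit (T : eqType) (e : rel T) (P : pred T) x s :
  path e x s -> P (last x s) -> exists s', [/\ path e x s', P (last x s'),
    {subset x :: s' <= x :: s} &
    forall v, v \in x :: s' ->
      [\/ ~~ P v, v = x | exists2 u, ~~ P u & e u v]].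
Proof.
elim: s x => [|y s IH] x /=.
  by move=> _ Px; exists [::]; split=> // v; rewrite inE => /eqP ->; constructor 2.
case/andP=> exy pys Pl.
have [Px|nPx] := boolP (P x).
  exists [::]; split=> // [v|v]; rewrite inE => /eqP ->; last by constructor 2.
  by rewrite mem_head.
have [s' [ps' Ps' sub H]] := IH y pys Pl.
exists (y :: s'); split=> //=; first by rewrite exy.
  move=> v; rewrite inE => /orP[/eqP ->|/sub vs]; first by rewrite mem_head.
  by rewrite inE vs orbT.
move=> v; rewrite inE => /orP[/eqP ->|/H]; first by constructor 2.
case=> [nPv|->|[u nPu euv]]; first by constructor 1.
  by constructor 3; exists x.
by constructor 3; exists u.
Qed.

(** Cut the path at [v] and reverse the first piece: this gives two paths issued from [v], one
    towards each end. *)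
Lemma path_through (T : eqType) (e : rel T) x s v : symmetric e ->
  path e x s -> v \in x :: s ->
  exists s1 s2, [/\ path e v s1, path e v s2, last v s1 = x,
    last v s2 = last x s & {subset v :: s1 <= x :: s} /\ {subset v :: s2 <= x :: s}].
Proof.
move=> es pxs vs; case/splitPl: vs pxs => s1 s2 <-.
rewrite cat_path last_cat => /andP[p1 p2].
exists (rev (belast x s1)), s2; split=> //.
- by rewrite rev_path (eq_path (e' := e)).
- by case: (s1) => //= y t; rewrite rev_cons last_rcons.
have sub1 : {subset x :: s1 <= x :: s1 ++ s2}.
  by move=> w ws; rewrite -cat_cons mem_cat ws.
split=> w; rewrite inE => /orP[/eqP ->|].
- exact/sub1/mem_last.
- by rewrite mem_rev => /mem_belast /sub1.
- exact/sub1/mem_last.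
- by move=> ws; rewrite -cat_cons mem_cat ws orbT.
Qed.

(** Consecutive vertices with equal images are merged, since edges of the covering graphs join
    distinct cells. *)
Lemma path_image (T T' : eqType) (e : rel T) (e' : rel T') (g : T -> T') x s :
  (forall u v, e u v -> g u != g v -> e' (g u) (g v)) -> path e x s ->
  exists s', [/\ path e' (g x) s', last (g x) s' = g (last x s) &
    {subset g x :: s' <= map g (x :: s)}].
Proof.
move=> ge; elim: s x => [|y s IH] x /=; first by exists [::]; split.
case/andP=> exy /IH[s' [ps' ls' sub]].
have [E|ne] := eqVneq (g x) (g y).
  exists s'; split; rewrite ?E// => v /sub /= vs.
  by rewrite inE vs orbT.
exists (g y :: s'); split=> //=; first by rewrite ge.
move=> v; rewrite !inE => /orP[->//|vs].
by have := sub v; rewrite /= !inE => /(_ vs) ->; rewrite orbT.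
Qed.

Lemma path_mdist_le (X : metricType R) (T : eqType) (e : rel T)
    (f : T -> X) (h : R) x s :
  (forall u v, e u v -> mdist (f u) (f v) <= h) -> path e x s ->
  mdist (f x) (f (last x s)) <= (size s)%:R * h.
Proof.
move=> eh; elim: s x => [|y s IH] x /=; first by rewrite mdistxx mul0r.
case/andP=> /eh exy /IH ys; apply: le_trans (metric_triangle _ (f y) _) _.
by rewrite -addn1 natrD mulrDl mul1r addrC lerD.
Qed.

(* Halving the radius m times leaves balls containing at most one of the
   points. *)
Lemma doubling_card (X : metricType R) (KD : R) (V : finType) (f : V -> X)
    (rho : R) (m : nat) (x : X) (r : R) (A : {set V}) :
  1 <= KD -> doubling X KD ->
  (forall v w, v != w -> ball (f v) rho `&` ball (f w) rho = set0) ->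
  0 < r -> r <= rho * 2 ^+ m -> {in A, forall v, mdist x (f v) < r} ->
  #|A|%:R <= KD ^+ m.
Proof.
move=> K1 dbl disj; elim: m x r A => [|m IH] x r A r0 rm Ar.
  (* Here [r <= rho], so [x] itself lies in the ball around each [f v], and disjointness leaves at
     most one. *)
  rewrite expr0 -[leRHS]/(1%:R) ler_nat; apply/card_le1_eqP => v w vA wA.
  apply/eqP/negPn/negP => /disj /seteqP[/(_ x) + _]; apply.
  rewrite expr0 mulr1 in rm.
  by split; rewrite ballEmdist/= metric_sym (lt_le_trans _ rm) ?Ar.
have [s sK cov] := dbl x r r0.
have r20 : 0 < r / 2 by rewrite divr_gt0.
have r2m : r / 2 <= rho * 2 ^+ m.
  by rewrite ler_pdivrMr// -mulrA -exprSr.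
pose A' y := [set v in A | mdist y (f v) < r / 2]%SET.
have A'K y : #|A' y|%:R <= KD ^+ m.
  by apply: (IH y _ _ r20 r2m) => v; rewrite inE => /andP[].
have AA' : (#|A| <= \sum_(y <- s) #|A' y|)%N.
  have sub : A \subset \bigcup_(y <- s) A' y.
    apply/fintype.subsetP => v vA.
    have [|y /= ys yv] := cov (f v); first by rewrite ballEmdist; exact: Ar.
    rewrite (big_rem y)//= finset.in_setU inE vA/=.
    by move: yv; rewrite ballEmdist/= => ->.
  apply: leq_trans (subset_leq_card sub) _.
  apply: (big_ind2 (fun (B : {set V}) n => (#|B| <= n)%N)) => //.
    by rewrite cards0.
  move=> B1 n1 B2 n2 h1 h2; apply: leq_trans (leq_add h1 h2).
  by rewrite cardsU leq_subr.
have {}AA' : #|A|%:R <= \sum_(y <- s) #|A' y|%:R :> R.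
  by rewrite -natr_sum ler_nat.
apply: le_trans AA' _; apply: (@le_trans _ _ (\sum_(y <- s) KD ^+ m)).
  exact: ler_sum.
rewrite big_const_seq count_predT iter_addr_0 -mulr_natl exprS.
by rewrite ler_wpM2r// exprn_ge0//; lra.
Qed.

End Preliminaries.

Lemma ler_sum_subset (R : numDomainType) (V : finType) (f : V -> R) (s1 s2 : seq V) :
  (forall v, 0 <= f v) -> {subset s1 <= s2} ->
  \sum_(v in s1) f v <= \sum_(v in s2) f v.
Proof.
move=> f0 sub; rewrite big_mkcond [leRHS]big_mkcond/=.
apply: ler_sum => v _; case: (boolP (v \in s1)) => [/sub ->//|_].
by case: ifP.
Qed.

(* MathComp-Analysis has a notation [center] for translations. *)
Local Notation center := Defs.center.
Local Notation graph U lambda N := (@edge _ _ _ _ U lambda N).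

(** * Scales, multiplicities and families of weights *)

Definition rad {R : realType} {X : metricType R} {kappa b : R}
  (U : coverings X kappa b) (n : nat) : R := kappa * b ^- n.

Section Weights.
Context {R : realType} {X : metricType R} {kappa b : R}.
Variables (U : coverings X kappa b) (lambda L : R).

(** The level [N] is tied to [n + k] by an equation, so that reassociating sums of levels requires
    no transport between types [U N]. *)
Definition cells_bound (mu : R) (k : nat) (D : R) : Prop := forall n N (x : X),
  (0 < n)%N -> N = (n + k)%N ->
  #|[pred v : U N | mdist x (center v) < mu * rad U n]|%:R <= D.

(* Widening the start and shortening the distance to travel, compared with
   [crossing_paths], leaves room for replacing a path of cells by the path of
   the larger cells containing their centers. *)
Definition fat {n N : nat} (B : U n) (rho : U N -> R) : Prop :=
  [/\ forall v, 0 <= rho v,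
      forall v, rho v != 0 -> mdist (center B) (center v) < 3 * rad U n &
      forall x s, path (graph U lambda N) x s -> mdist (center B) (center x) < 2 * rad U n ->
        rad U n / 2 <= mdist (center x) (center (last x s)) ->
        1 <= \sum_(v in x :: s) rho v].

Definition fat_weights (p : R) (l : nat) (T : R) : Prop := forall n N (B : U n),
  (0 < n)%N -> N = (n + l)%N ->
  exists2 rho : U N -> R, fat B rho & \sum_v rho v `^ p <= T.

Definition crossing_weights (p : R) (k : nat) (theta : R) : Prop := forall n (B : U n),
  (0 < n)%N -> exists2 rho : U (n + k)%N -> R,
    admissible (crossing_paths U lambda L B k) rho &
    \sum_v rho v `^ p <= theta.

End Weights.

(** * Geometry of cells and edges *)

Lemma rad_gt0 (R : realType) (X : metricType R) (kappa b : R)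
    (U : coverings X kappa b) n :
  1 < kappa -> 1 < b ->
  0 < rad U n.
Proof. by move=> kappa1 b1; rewrite mulr_gt0 ?invr_gt0 ?exprn_gt0//; lra. Qed.

Lemma radD (R : realType) (X : metricType R) (kappa b : R)
    (U : coverings X kappa b) n k :
  rad U (n + k) = rad U n * b^-1 ^+ k.
Proof. by rewrite /rad exprD invfM mulrA exprVn. Qed.

Lemma invb_itv (R : realType) (b : R) : 1 < b -> 0 <= b^-1 < 1.
Proof.
by move=> b1; rewrite invr_ge0 invf_lt1; first apply/andP; first split; lra.
Qed.

Lemma exprV_le1 (R : realType) (b : R) k : 1 < b -> 0 <= b^-1 ^+ k <= 1.
Proof.
by move=> /invb_itv/andP[? ?]; rewrite exprn_ge0//= exprn_ile1// ltW.
Qed.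

Lemma exprVD_le (R : realType) (b : R) m k : 1 < b ->
  b^-1 ^+ (m + k) <= b^-1 ^+ k.
Proof.
move=> b1; rewrite exprD ler_piMl//.
  by have /andP[] := exprV_le1 k b1.
by have /andP[] := exprV_le1 m b1.
Qed.

(** The ratio of [mu * rad U n] to the radius of the disjoint inner balls is [mu * kappa^2 * b^k],
    whatever [n]. Hence [D] can be chosen before the space and its coverings. *)
Lemma cells_card (R : realType) (kappa b KD mu : R) (k : nat) :
  1 < kappa -> 1 < b -> 1 <= KD -> 0 < mu ->
  exists2 D : R, 1 <= D & forall (X : metricType R) (U : coverings X kappa b),
    doubling X KD -> cells_bound U mu k D.
Proof.
move=> kappa1 b1 K1 mu0.
have h2 : 0 <= (2^-1 : R) < 1 by lra.
have bk0 : 0 < b ^+ k by rewrite exprn_gt0//; lra.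
have a0 : 0 < mu * kappa * kappa * b ^+ k by rewrite !mulr_gt0//; lra.
have [m _ hm] := small_exprn h2 (ltW a0).
exists (KD ^+ m) => [|X U dbl n N x n0 ->]; first exact: exprn_ege1.
have nk0 : (0 < n + k)%N by rewrite addn_gt0 n0.
have bn0 : 0 < b ^+ n by rewrite exprn_gt0//; lra.
rewrite -cardsE.
apply: (@doubling_card _ X KD _ (@center _ _ _ _ U _)
  (kappa^-1 * b ^- (n + k)) m x (mu * rad U n)) => //.
- by move=> v w vw; exact: cell_disjoint.
- by rewrite mulr_gt0 ?rad_gt0.
- rewrite /rad exprD invfM.
  rewrite exprVn ltr_pdivrMr ?exprn_gt0// mul1r in hm.
  have -> : mu * (kappa * b ^- n) =
    mu * kappa * kappa * b ^+ k * (kappa^-1 * (b ^- n / b ^+ k)).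
    by field; rewrite !gt_eqF//; lra.
  rewrite mulrC ler_wpM2l// ?(ltW hm)//.
  by rewrite !mulr_ge0 ?invr_ge0 ?ltW//; lra.
- by move=> v; rewrite inE.
Qed.

Lemma edge_sym (R : realType) (X : metricType R) (kappa b : R)
    (U : coverings X kappa b) lambda k :
  symmetric (graph U lambda k).
Proof. by move=> u v; rewrite /edge eq_sym setIC. Qed.

Lemma edge_mdist (R : realType) (X : metricType R) (kappa b : R)
    (U : coverings X kappa b) lambda k
    (u v : U k) : edge lambda u v ->
  mdist (center u) (center v) < 2 * lambda * rad U k.
Proof.
move=> /andP[_ /asboolP[z []]]; rewrite /dilate !ballEmdist/= => uz vz.
have := metric_triangle (center u) z (center v).
by rewrite (metric_sym z) /rad; lra.
Qed.

Lemma mdist_edge (R : realType) (X : metricType R) (kappa b : R)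
    (U : coverings X kappa b) lambda k
    (u v : U k) (z : X) : u != v ->
  mdist (center u) z < lambda * rad U k -> mdist (center v) z < lambda * rad U k ->
  edge lambda u v.
Proof.
move=> uv uz vz; rewrite /edge uv; apply/asboolP; exists z.
by rewrite /dilate !ballEmdist/= -!mulrA.
Qed.

Lemma cell_mdist (R : realType) (X : metricType R) (kappa b : R)
    (U : coverings X kappa b) k
    (u : U k) z : (0 < k)%N -> cell u z ->
  mdist (center u) z < rad U k.
Proof. by move=> k0 /(cell_outer k0); rewrite ballEmdist. Qed.

Lemma cell_exists (R : realType) (X : metricType R) (kappa b : R)
    (U : coverings X kappa b) k
    (z : X) : (0 < k)%N -> exists u : U k, cell u z.
Proof.
by move=> k0; have : [set: X] z by []; rewrite -(cell_cover U k0) => -[u _]; exists u.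
Qed.

Lemma crossing_admissibleP (R : realType) (X : metricType R) (kappa b : R)
    (U : coverings X kappa b) lambda L n
    (B : U n) k (rho : U (n + k)%N -> R) :
  admissible (crossing_paths U lambda L B k) rho <->
  (forall v, 0 <= rho v) /\
  (forall x s, path (graph U lambda (n + k)) x s -> cell B (center x) ->
    L * rad U n <= mdist (center B) (center (last x s)) ->
    1 <= \sum_(v in x :: s) rho v).
Proof.
split=> -[rho0 H]; split=> //.
  move=> x s pxs Bx far.
  have := H [set v in x :: s]%SET.
  rewrite (eq_bigl (mem (x :: s))); last by move=> v; rewrite inE.
  apply; exists x, s; split=> //; rewrite /dilate ballEmdist/=.
  by rewrite -mulrA => /(le_lt_trans far); rewrite ltxx.
move=> g [x [s [pxs Bx far ->]]].
rewrite (eq_bigl (mem (x :: s))); last by move=> v; rewrite inE.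
apply: H => //; rewrite leNgt; apply/negP => h; apply: far.
by rewrite /dilate ballEmdist/= -mulrA.
Qed.


(** * Composition of weights across scales *)

(** Weight 1 on every cell near [B] suffices, as the first vertex of a path already has weight 1. *)
Lemma fat_weights_base (R : realType) (X : metricType R) (kappa b : R)
    (U : coverings X kappa b) lambda p l D :
  1 < kappa -> 1 < b -> 0 < p -> cells_bound U 3 l D ->
  fat_weights U lambda p l D.
Proof.
move=> kappa1 b1 p0 cD n N B n0 nl.
have r0 := rad_gt0 U n kappa1 b1.
exists (fun v : U N => if mdist (center B) (center v) < 3 * rad U n then 1 else 0).
  split=> [v|v|x s _ xB _].
  - by case: ifP.
  - by case: ifP => // _; rewrite eqxx.
  rewrite (bigD1 x) ?mem_head//=.
  have -> : mdist (center B) (center x) < 3 * rad U n by lra.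
  by rewrite lerDl sumr_ge0// => v _; case: ifP.
rewrite (le_trans _ (cD n N (center B) n0 nl))//.
rewrite -sum1_card natr_sum [leRHS]big_mkcond/= ler_sum// => v _.
by rewrite inE; case: ifP => _; rewrite ?powR1 ?powR0// gt_eqF.
Qed.

(* First exit from the ball of radius [rad U n / 2] around the first center. *)
Lemma fat_exit (R : realType) (X : metricType R) (kappa b : R)
    (U : coverings X kappa b) lambda n N
    (B : U n) (x : U N) s :
  1 < kappa -> 1 < b -> 2 * lambda * rad U N <= rad U n / 2 ->
  path (graph U lambda N) x s -> mdist (center B) (center x) < 2 * rad U n ->
  rad U n / 2 <= mdist (center x) (center (last x s)) ->
  exists s', [/\ path (graph U lambda N) x s', {subset x :: s' <= x :: s},
    rad U n / 2 <= mdist (center x) (center (last x s')) &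
    forall v, v \in x :: s' -> mdist (center B) (center v) < 3 * rad U n].
Proof.
move=> kappa1 b1 step pxs xB far.
pose P := [pred v : U N | rad U n / 2 <= mdist (center x) (center v)].
have r0 := rad_gt0 U n kappa1 b1.
have [s' [ps' Ps' sub near]] := @path_first_exit _ _ P x s pxs far.
exists s'; split=> // v /near near_v.
have tri := metric_triangle (center B) (center x) (center v).
case: near_v => [|->|[u]]; rewrite /= -?ltNge; try lra.
move=> xu /edge_mdist uv.
have := metric_triangle (center x) (center u) (center v).
lra.
Qed.


Lemma fat_weights_comp (R : realType) (X : metricType R) (kappa b : R)
    (U : coverings X kappa b) (lambda L p : R) (k l j : nat) (D theta T : R) :
  1 < kappa -> 1 < b -> 32 <= lambda -> 0 < p ->
  2 * lambda * b^-1 ^+ l <= 2^-1 -> (L + 3) * b^-1 ^+ j <= 2^-1 -> 2 <= L ->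
  1 <= D -> cells_bound U 3 0 D -> cells_bound U 3 j D ->
  0 <= theta -> 0 <= T ->
  crossing_weights U lambda L p k theta -> fat_weights U lambda p l T ->
  fat_weights U lambda p (j + k + l) (D * (D `^ p * D `^ p) * theta * T).
Proof.
move=> kappa1 b1 lambda32 p0 hl hj L2 D1 cD0 cDj th0 T0 cross fw n N B n0 EN.
pose n' := (n + j + k)%N.
have nj0 : (0 < n + j)%N by rewrite addn_gt0 n0.
have n'0 : (0 < n')%N by rewrite addn_gt0 nj0.
have EN' : N = (n' + l)%N by rewrite EN /n' !addnA.
pose near_B := [pred C : U (n + j)%N | mdist (center B) (center C) < 3 * rad U n].
have [sigma sigmaP] : {sigma : forall C : U (n + j)%N, U n' -> R |
    forall C, admissible (crossing_paths U lambda L C k) (sigma C) /\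
      \sum_v sigma C v `^ p <= theta}.
  have := @choice _ _ (fun (C : U (n + j)%N) (rho : U n' -> R) =>
    admissible (crossing_paths U lambda L C k) rho /\
      \sum_v rho v `^ p <= theta).
  case=> [C|f fP]; last by exists f.
  by have [rho ? ?] := cross _ C nj0; exists rho.
have [tau tauP] : {tau : U n' -> U N -> R |
    forall C, fat lambda C (tau C) /\ \sum_v tau C v `^ p <= T}.
  have := @choice _ _ (fun (C : U n') (rho : U N -> R) =>
    fat lambda C rho /\ \sum_v rho v `^ p <= T).
  case=> [C|f fP]; last by exists f.
  by have [rho ? ?] := fw _ _ C n'0 EN'; exists rho.
have sigma0 C v : 0 <= sigma C v.
  by have [/crossing_admissibleP[+ _] _] := sigmaP C; exact.
have tau0 C v : 0 <= tau C v by have [[+ _ _] _] := tauP C; exact.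
(* The cell of level [n + j] from which the shadow starts depends on the path, so all candidates
   near [B] are summed. *)
pose s C := \sum_(E in near_B) sigma E C.
have s0 C : 0 <= s C by exact: sumr_ge0.
pose mix v := \sum_C s C * tau C v.
have mix0 v : 0 <= mix v by apply: sumr_ge0 => C _; rewrite mulr_ge0.
(* The cut-off gives the support condition; paths stopped at first exit do not feel it. *)
pose rho v := if mdist (center B) (center v) < 3 * rad U n then mix v else 0.
have rho0 v : 0 <= rho v by rewrite /rho; case: ifP.
have r0 := rad_gt0 U n kappa1 b1.
have r'0 := rad_gt0 U n' kappa1 b1.
have rj0 := rad_gt0 U (n + j) kappa1 b1.
have Erj : rad U (n + j) = rad U n * b^-1 ^+ j by rewrite radD.
have Ern' : rad U n' = rad U (n + j) * b^-1 ^+ k by rewrite -radD.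
have ErN : rad U N = rad U n' * b^-1 ^+ l by rewrite -radD -EN'.
have r'_le : rad U n' <= rad U (n + j).
  by rewrite Ern' ler_piMr ?(ltW rj0)//; have /andP[] := exprV_le1 k b1.
have hjr : (L + 3) * rad U (n + j) <= rad U n / 2.
  by rewrite Erj mulrCA ler_wpM2l// ltW.
have hlr' : 2 * lambda * rad U N <= rad U n' / 2.
  by rewrite ErN mulrCA ler_wpM2l// ltW.
have r'r : rad U n' <= rad U n / 2.
  have : (L + 3) * rad U (n + j) >= 1 * rad U (n + j).
    by rewrite ler_wpM2r ?(ltW rj0)//; lra.
  by lra.
have rj5 : 5 * rad U (n + j) <= rad U n / 2.
  by apply: le_trans hjr; rewrite ler_wpM2r ?(ltW rj0)//; lra.
exists rho.
  split=> //.
    by move=> v; rewrite /rho; case: ifP => // _; rewrite eqxx.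
  move=> x t pxt xB far.
  have hlr : 2 * lambda * rad U N <= rad U n / 2 by lra.
  have [t' [pxt' sub far' near]] := fat_exit kappa1 b1 hlr pxt xB far.
  apply: le_trans (ler_sum_subset rho0 sub).
  have [g gP] := @choice _ _ (fun (v : U N) (C : U n') => cell C (center v))
    (fun v => cell_exists U (center v) n'0).
  have gd v : mdist (center (g v)) (center v) < rad U n' by exact: cell_mdist.
  (* The center of [u] is within [3/2 * rad U n'] of both centers, far less than
     [lambda * rad U n']. *)
  have gedge u v : edge lambda u v -> g u != g v -> edge lambda (g u) (g v).
    move=> /edge_mdist uv guv; apply: (mdist_edge (z := center u)) => //.
      apply: lt_le_trans (gd u) _; rewrite ler_peMl ?ltW//; lra.
    have := metric_triangle (center (g v)) (center v) (center u).
    rewrite (metric_sym (center v)); have := gd v.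
    have : 32 * rad U n' <= lambda * rad U n' by rewrite ler_wpM2r ?(ltW r'0).
    by lra.
  have [q [pq lq subq]] := path_image gedge pxt'.
  have [C0 C0x] := cell_exists U (center (g x)) nj0.
  have C0d := cell_mdist nj0 C0x.
  have C0B : C0 \in near_B.
    rewrite inE.
    have := metric_triangle (center B) (center (g x)) (center C0).
    have := metric_triangle (center B) (center x) (center (g x)).
    rewrite (metric_sym (center x) (center (g x))).
    rewrite (metric_sym (center (g x)) (center C0)).
    by have := gd x; lra.
  (* Passing to [C0], [g x] and [g y] costs at most [3 * rad U (n + j)] of the distance
     [rad U n / 2]; this is the 3 in [L + 3]. *)
  have sigma1 : 1 <= \sum_(C in g x :: q) sigma C0 C.
    have [/crossing_admissibleP[_ +] _] := sigmaP C0; apply=> //.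
    rewrite lq; set y := last x t' in far' *.
    have := metric_triangle (center x) (center (g x)) (center y).
    have := metric_triangle (center (g x)) (center C0) (center y).
    have := metric_triangle (center C0) (center (g y)) (center y).
    rewrite (metric_sym (center x) (center (g x))).
    rewrite (metric_sym (center (g x)) (center C0)).
    by have := gd x; have := gd y; lra.
  have -> : \sum_(v in x :: t') rho v =
      \sum_C s C * \sum_(v in x :: t') tau C v.
    under [RHS]eq_bigr do rewrite mulr_sumr.
    by rewrite exchange_big/=; apply: eq_bigr => v /near vB; rewrite /rho vB.
  apply: le_trans sigma1 _; rewrite big_mkcond/=; apply: ler_sum => C _.
  case: ifP => [Cq|_]; last by rewrite mulr_ge0// sumr_ge0.
  have sC : sigma C0 C <= s C.
    by rewrite /s (bigD1 C0)//= lerDl sumr_ge0.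
  apply: le_trans sC _; rewrite ler_peMr//.
  have /mapP[v vt ->] := subq C Cq.
  have [[_ _ fatv] _] := tauP (g v).
  have [s1 [s2 [p1 p2 l1 l2 [sub1 sub2]]]] :=
    path_through (@edge_sym _ _ _ _ U lambda N) pxt' vt.
  have vd : mdist (center (g v)) (center v) < 2 * rad U n'.
    by have := gd v; lra.
  have := metric_triangle (center x) (center v) (center (last x t')).
  rewrite (metric_sym (center x) (center v)).
  (* The ends of the path are at least [rad U n / 2 >= rad U n'] apart, so one of them is at least
     [rad U n' / 2] away from [v]. *)
  have [h _|h tri] := leP (rad U n' / 2) (mdist (center v) (center x)).
    apply: le_trans (ler_sum_subset (tau0 _) sub1).
    by apply: fatv; rewrite ?l1.
  apply: le_trans (ler_sum_subset (tau0 _) sub2).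
  by apply: fatv; rewrite ?l2//; lra.
(* By the support condition on [tau], only cells [C] of level [n'] close to [v] contribute, at most
   [D] of them. *)
have rho_le v : rho v `^ p <= D `^ p * \sum_C s C `^ p * tau C v `^ p.
  apply: (@le_trans _ _ (mix v `^ p)).
    by rewrite ge0_ler_powR ?nnegrE ?(ltW p0)// /rho; case: ifP.
  pose close := [pred C : U n' | mdist (center v) (center C) < 3 * rad U n'].
  have -> : mix v = \sum_(C | close C) s C * tau C v.
    rewrite /mix [RHS]big_mkcond/=; apply: eq_bigr => C _.
    case: ifPn => // h; have [[_ supp _] _] := tauP C.
    have [->|/supp] := eqVneq (tau C v) 0; first by rewrite mulr0.
    by rewrite metric_sym (negbTE h).
  apply: (@le_trans _ _ (D `^ p * \sum_(C | close C) (s C * tau C v) `^ p)).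
    apply: powR_sum_le => //; first by move=> C; rewrite mulr_ge0.
    by apply: cD0; rewrite ?addn0.
  rewrite ler_wpM2l ?powR_ge0// big_mkcond/=; apply: ler_sum => C _.
  by case: ifP => _; rewrite ?powRM// mulr_ge0// powR_ge0.
apply: le_trans (ler_sum _ (fun v _ => rho_le v)) _.
rewrite -mulr_sumr exchange_big/=.
(* [near_B] has at most [D] cells: this costs [D^p] for the power of the sum, and [D] for adding
   their energies. *)
have s_le : \sum_C s C `^ p <= D `^ p * (D * theta).
  apply: (@le_trans _ _ (\sum_C D `^ p * \sum_(E in near_B) sigma E C `^ p)).
    apply: ler_sum => C _; apply: powR_sum_le => //.
    exact: cDj.
  rewrite -mulr_sumr exchange_big/= ler_wpM2l ?powR_ge0//.
  apply: (@le_trans _ _ (\sum_(E in near_B) theta)).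
    by apply: ler_sum => C _; have [_] := sigmaP C.
  rewrite sumr_const -mulr_natl ler_wpM2r//.
  exact: cDj.
apply: (@le_trans _ _ (D `^ p * ((D `^ p * (D * theta)) * T))); last first.
  by rewrite le_eqVlt; apply/orP; left; apply/eqP; ring.
rewrite ler_wpM2l ?powR_ge0//.
apply: (@le_trans _ _ (\sum_C s C `^ p * T)); last first.
  by rewrite -mulr_suml ler_wpM2r.
apply: ler_sum => C _; rewrite -mulr_sumr ler_wpM2l ?powR_ge0//.
by have [_] := tauP C.
Qed.

(** * From weights to the critical exponent *)

Lemma limn_einf_eq0 (R : realType) (u : (\bar R)^nat) :
  (forall k, 0 <= u k)%E ->
  (forall (e : R) n, 0 < e -> exists2 k, (n <= k)%N & (u k <= e%:E)%E) ->
  limn_einf u = 0%E.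
Proof.
move=> u0 usmall; rewrite limn_einf_lim.
suff -> : einfs u = cst 0%E by rewrite lim_cst.
apply/funext => n; apply/eqP; rewrite eq_le; apply/andP; split.
  apply/lee_addgt0Pr => e e0; rewrite add0e.
  have [k nk uk] := usmall e n e0.
  by apply: le_trans uk; apply: ereal_inf_lbound; exists k.
by apply/ereal_infP => _ [k _ <-].
Qed.

Lemma sup_modulus_ge0 (R : realType) (X : metricType R) (kappa b : R)
    (U : coverings X kappa b) (lambda p L : R) k :
  [set: X] !=set0 -> (0 <= sup_modulus U lambda p k L)%E.
Proof.
case=> x _; have [B _] := cell_exists U x (ltn0Sn 0).
apply: le_ereal_sup_tmp.
exists (modulus p (crossing_paths U lambda L B k)); first by exists 1%N, B.
apply/ereal_infP => _ [rho _ <-].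
by rewrite lee_fin sumr_ge0// => v _; exact: powR_ge0.
Qed.

(** A path from a center in [B] to the outside of [2 B] travels at least [rad U n], more than the
    [rad U n / 2] that [fat] asks for. *)
Lemma sup_modulus_fat (R : realType) (X : metricType R) (kappa b : R)
    (U : coverings X kappa b) (lambda p T : R) l :
  1 < kappa -> 1 < b -> fat_weights U lambda p l T ->
  (sup_modulus U lambda p l 2 <= T%:E)%E.
Proof.
move=> kappa1 b1 fw; apply: ge_ereal_sup => _ [n [B [n0 ->]]].
have [rho [rho0 _ fatB] rhoT] := fw n _ B n0 erefl.
rewrite -lee_fin in rhoT; apply: le_trans rhoT.
apply: ereal_inf_lbound; exists rho => //.
apply/crossing_admissibleP; split=> // x s pxs Bx far.
have r0 := rad_gt0 U n kappa1 b1.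
have xB := cell_mdist n0 Bx.
apply: fatB => //; first lra.
have := metric_triangle (center B) (center x) (center (last x s)); lra.
Qed.

Lemma critical_exponent_le (R : realType) (X : metricType R) (kappa b : R)
    (U : coverings X kappa b) (lambda L p : R) (k l j : nat) (D theta : R) :
  1 < kappa -> 1 < b -> 32 <= lambda -> 2 <= L -> [set: X] !=set0 -> 0 < p ->
  (0 < j)%N ->
  2 * lambda * b^-1 ^+ l <= 2^-1 -> (L + 3) * b^-1 ^+ j <= 2^-1 ->
  1 <= D -> cells_bound U 3 0 D -> cells_bound U 3 j D -> cells_bound U 3 l D ->
  0 <= theta -> crossing_weights U lambda L p k theta ->
  D * (D `^ p * D `^ p) * theta < 1 ->
  (critical_exponent U lambda <= p%:E)%E.
Proof.
move=> kappa1 b1 lambda32 L2 X0 p0 j0 hl hj D1 cD0 cDj cDl th0 cross.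
set q := D * _ * theta => q1.
have D0 : 0 < D by lra.
have q0 : 0 <= q by rewrite !mulr_ge0 ?powR_ge0// ltW.
have qD m : 0 <= q ^+ m * D by rewrite mulr_ge0 ?exprn_ge0 ?(ltW D0).
(* Each composition multiplies the energy by [q], deepens the level since [0 < j], and preserves the
   smallness condition needed for the next one. *)
have fats m : exists l', [/\ (m <= l')%N, 2 * lambda * b^-1 ^+ l' <= 2^-1 &
    fat_weights U lambda p l' (q ^+ m * D)].
  elim: m => [|m [l' [ml hl' fw]]].
    by exists l; split=> //; rewrite expr0 mul1r; exact: fat_weights_base.
  exists (j + k + l')%N; split.
  - by rewrite -addnA -add1n leq_add// (leq_trans ml)// leq_addl.
  - by apply: le_trans hl'; rewrite ler_wpM2l ?exprVD_le//; lra.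
  rewrite exprS -[q * _ * D]mulrA.
  exact: (@fat_weights_comp _ _ _ _ U lambda L) fw.
apply: ereal_inf_lbound; exists p => //; split=> //.
apply: limn_einf_eq0 => [n|e n e0]; first exact: sup_modulus_ge0.
have q01 : 0 <= q < 1 by rewrite q0.
have De0 : 0 <= D / e by rewrite divr_ge0// ltW.
have [m _ hm] := small_exprn q01 De0.
(* [m] compositions make the energy small and [n] more bring the depth beyond [n]. *)
have [l' [ml _ fw]] := fats (m + n)%N.
exists l'; first exact: leq_trans (leq_addl _ _) ml.
apply: le_trans (sup_modulus_fat kappa1 b1 fw) _; rewrite lee_fin.
apply: (@le_trans _ _ (q ^+ m * D)).
  rewrite ler_wpM2r ?(ltW D0)// exprD ler_piMr ?exprn_ge0//.
  by rewrite exprn_ile1// ltW.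
have -> : q ^+ m * D = (D / e * q ^+ m) * e by field; rewrite gt_eqF.
by rewrite ler_piMl// ltW.
Qed.

(* The first center of a path outside [L B] is at distance at most
   [2 lambda rad n] from its predecessor, which lies in [L B]. *)
Lemma admissible_cutoff (R : realType) (X : metricType R) (kappa b : R)
    (U : coverings X kappa b) (lambda L : R) n (B : U n) k
    (rho : U (n + k)%N -> R) :
  1 < kappa -> 1 < b -> 32 <= lambda -> 2 <= L -> (0 < n)%N ->
  admissible (crossing_paths U lambda L B k) rho ->
  admissible (crossing_paths U lambda L B k)
    (fun v => if mdist (center B) (center v) < (L + 2 * lambda) * rad U n
              then rho v else 0).
Proof.
move=> kappa1 b1 lambda32 L2 n0 /crossing_admissibleP[rho0 adm].
apply/crossing_admissibleP; split; first by move=> v; case: ifP.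
move=> x s pxs Bx far.
have r0 := rad_gt0 U n kappa1 b1.
have xB := cell_mdist n0 Bx.
pose P := [pred v : U (n + k)%N | L * rad U n <= mdist (center B) (center v)].
have [s' [ps' Ps' sub near]] := @path_first_exit _ _ P x s pxs far.
have Lr : L * rad U n >= 2 * rad U n by rewrite ler_wpM2r// ltW.
have lr : lambda * rad U n >= 32 * rad U n by rewrite ler_wpM2r// ltW.
have lrk : lambda * rad U (n + k) <= lambda * rad U n.
  rewrite ler_wpM2l//; first by lra.
  by rewrite radD ler_piMr ?(ltW r0)//; have /andP[] := exprV_le1 k b1.
have {}near v : v \in x :: s' ->
    mdist (center B) (center v) < (L + 2 * lambda) * rad U n.
  move=> /near; case=> [|->|[u]]; rewrite /= -?ltNge; try lra.
  move=> uB /edge_mdist uv.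
  have := metric_triangle (center B) (center u) (center v).
  lra.
apply: le_trans (adm x s' ps' Bx Ps') _.
apply: (@le_trans _ _ (\sum_(v in x :: s')
    if mdist (center B) (center v) < (L + 2 * lambda) * rad U n
    then rho v else 0)).
  by apply: ler_sum => v /near ->.
by apply: ler_sum_subset sub => v; case: ifP.
Qed.

(** * Constant weights, and lowering the exponent *)

(** An edge advances by at most [2 * lambda * b^-k * rad U n], and a crossing path must advance by
    [rad U n]. *)
Lemma uniform_weights (R : realType) (X : metricType R) (kappa b : R)
    (U : coverings X kappa b) (lambda L p N : R) (k : nat) :
  1 < kappa -> 1 < b -> 32 <= lambda -> 2 <= L -> 0 < p ->
  cells_bound U (L + 2 * lambda) k N ->
  crossing_weights U lambda L p k (N * (2 * lambda * b^-1 ^+ k) `^ p).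
Proof.
move=> kappa1 b1 lambda32 L2 p0 cN n B n0.
set w := 2 * lambda * _.
have w0 : 0 <= w.
  by rewrite mulr_ge0//; [lra|have /andP[] := exprV_le1 k b1].
have r0 := rad_gt0 U n kappa1 b1.
exists (fun v => if mdist (center B) (center v) < (L + 2 * lambda) * rad U n
                 then w else 0).
  apply: admissible_cutoff => //; apply/crossing_admissibleP; split=> //.
  move=> x s pxs Bx far; have xB := cell_mdist n0 Bx.
  (* Each vertex counts once in the sum, so repetitions are removed before comparing it with the
     length. *)
  case: (shortenP pxs) far => s' ps' us' sub far.
  have sub' : {subset x :: s' <= x :: s}.
    by move=> v; rewrite !inE => /orP[->//|/sub ->]; rewrite orbT.
  apply: (@le_trans _ _ (\sum_(v in x :: s') w)); last first.
    exact: (ler_sum_subset (fun _ => w0) sub').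
  rewrite sumr_const (card_uniqP us') -mulr_natl /= -addn1 natrD mulrDl mul1r.
  have edge_le (u v : U (n + k)%N) :
      edge lambda u v -> mdist (center u) (center v) <= w * rad U n.
    move=> /edge_mdist/ltW; rewrite radD /w => h.
    by apply: le_trans h _; rewrite le_eqVlt; apply/orP; left; apply/eqP; ring.
  have := path_mdist_le edge_le ps'.
  have := metric_triangle (center B) (center x) (center (last x s')).
  have Lr : L * rad U n >= 2 * rad U n by rewrite ler_wpM2r// ltW.
  move=> h1 h2; have : 1 * rad U n <= (size s')%:R * w * rad U n.
    by rewrite -mulrA; lra.
  by rewrite ler_pM2r//; lra.
apply: (@le_trans _ _ (\sum_(v : U (n + k)%N |
    mdist (center B) (center v) < (L + 2 * lambda) * rad U n) w `^ p)).
  rewrite [leRHS]big_mkcond/=; apply: ler_sum => v _.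
  by case: ifP => // _; rewrite powR0// gt_eqF.
by rewrite sumr_const -[leLHS]mulr_natl ler_wpM2r ?powR_ge0//; exact: cN.
Qed.

(** Take [p = Q - d]. For [t <= tau], [t^p <= tau^(Q/2) <= e], as [d <= Q/2]. For [t > tau],
    [t^(-d) <= tau^(-d) <= 2] by the second bound on [d]. *)
Lemma powR_perturb (R : realType) (Q e : R) : 0 < Q -> 0 < e ->
  exists2 p : R, 0 < p < Q & forall t, 0 <= t -> t `^ p <= e + 2 * t `^ Q.
Proof.
move=> Q0 e0.
pose tau := Num.min 2^-1 (e `^ (2 / Q)).
have tau0 : 0 < tau by rewrite lt_min powR_gt0// invr_gt0 ltr0n.
have tau1 : tau < 1.
  by rewrite gt_min; apply/orP; left; lra.
have lntau : 0 < - ln tau by rewrite oppr_gt0 ln_lt0// tau0.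
have ln2 : 0 < ln (2 : R) by rewrite ln_gt0// ltr1n.
pose d := Num.min (Q / 2) (ln 2 / - ln tau).
have d0 : 0 < d by rewrite lt_min !divr_gt0.
have dQ : d <= Q / 2 by rewrite ge_min lexx.
have dln : d * - ln tau <= ln 2.
  by rewrite -ler_pdivlMr// ge_min lexx orbT.
exists (Q - d); first by apply/andP; split; lra.
move=> t t0; have [tt|tt] := leP t tau.
  apply: (@le_trans _ _ e); last by rewrite lerDl mulr_ge0// powR_ge0.
  apply: (@le_trans _ _ (tau `^ (Q - d))).
    by rewrite ge0_ler_powR ?nnegrE ?(ltW tau0)//; lra.
  apply: (@le_trans _ _ (tau `^ (Q / 2))).
    by apply: ger_powR; [rewrite tau0 ltW|lra].
  apply: (@le_trans _ _ ((e `^ (2 / Q)) `^ (Q / 2))).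
    rewrite ge0_ler_powR ?nnegrE ?powR_ge0 ?(ltW tau0)//; first by lra.
    by rewrite ge_min lexx orbT.
  rewrite -powRrM (_ : 2 / Q * (Q / 2) = 1); last by field; rewrite gt_eqF.
  by rewrite powRr1// ltW.
have tp : 0 < t by exact: lt_trans tt.
rewrite powRB ?(gt_eqF tp) ?implybT//.
have : 2^-1 <= t `^ d.
  apply: (@le_trans _ _ (tau `^ d)); last first.
    by rewrite ge0_ler_powR ?nnegrE ?(ltW tau0) ?(ltW tp) ?(ltW d0)// ltW.
  rewrite /powR gt_eqF// -[2^-1]lnK ?posrE ?invr_gt0// ler_expR lnV ?posrE//; lra.
move=> h; rewrite mulrC; apply: (@le_trans _ _ (2 * t `^ Q)); last by rewrite lerDr ltW.
rewrite ler_wpM2r ?powR_ge0//.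
by rewrite invf_ple ?posrE ?powR_gt0.
Qed.

Lemma crossing_weights_perturb (R : realType) (X : metricType R) (kappa b : R)
    (U : coverings X kappa b) (lambda L Q N c : R) (k : nat) :
  1 < kappa -> 1 < b -> 32 <= lambda -> 2 <= L -> 0 < Q -> 0 < c -> 1 <= N ->
  cells_bound U (L + 2 * lambda) k N ->
  (sup_modulus U lambda Q k L < c%:E)%E ->
  exists2 p, 0 < p < Q & crossing_weights U lambda L p k (3 * c).
Proof.
move=> kappa1 b1 lambda32 L2 Q0 c0 N1 cN supc.
have N0 : 0 < N by lra.
(* An error [c / N] on each of at most [N] cells totals [c], for every [B] at once; with [2 * c]
   from the [Q]-energy this gives [3 * c]. *)
have [p pQ ptb] := powR_perturb Q0 (divr_gt0 c0 N0).
have /andP[p0 _] := pQ.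
exists p => // n B n0.
have [_ [rho adm <-]] : exists2 y,
    [set (\sum_v rho v `^ Q)%:E | rho in
      admissible (crossing_paths U lambda L B k)] y & (y < c%:E)%E.
  apply: ereal_inf_lt; apply: le_lt_trans supc.
  by apply: ereal_sup_ubound; exists n, B.
rewrite lte_fin => rhoc.
have [rho0 _] := adm.
exists (fun v => if mdist (center B) (center v) < (L + 2 * lambda) * rad U n
                 then rho v else 0); first exact: admissible_cutoff.
apply: (@le_trans _ _ (\sum_(v : U (n + k)%N |
    mdist (center B) (center v) < (L + 2 * lambda) * rad U n)
      (c / N + 2 * rho v `^ Q))).
  rewrite [leRHS]big_mkcond/=; apply: ler_sum => v _.
  by case: ifP => _; [exact: ptb|rewrite powR0// gt_eqF].
rewrite big_split/= sumr_const -[_ *+ #|_|]mulr_natl -mulr_sumr.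
have h1 : #|[pred v : U (n + k)%N |
    mdist (center B) (center v) < (L + 2 * lambda) * rad U n]|%:R * (c / N) <= c.
  rewrite mulrA ler_pdivrMr// mulrC ler_wpM2l ?(ltW c0)//; exact: cN.
have h2 : \sum_(v : U (n + k)%N |
    mdist (center B) (center v) < (L + 2 * lambda) * rad U n) rho v `^ Q
    <= \sum_v rho v `^ Q.
  by rewrite big_mkcond/=; apply: ler_sum => v _; case: ifP => // _; exact: powR_ge0.
by apply: le_trans (lerD h1 (ler_wpM2l _ h2)) _ => //; lra.
Qed.

Unset Implicit Arguments.

(* The critical exponent of a doubling space is finite; [fine] only converts it
   from an extended real to a real. *)
Theorem corollary3p9 (R : realType) (kappa b lambda L KD : R) :
  1 < kappa -> 1 < b -> 32 <= lambda -> 2 <= L -> 1 <= KD ->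
  exists2 c : R, 0 < c &
    forall (X : metricType R) (U : coverings X kappa b),
      [set: X] !=set0 ->
      compact [set: X] ->
      doubling X KD ->
      uniformly_perfect X ->
      (0 < critical_exponent U lambda)%E ->
      forall k : nat, (0 < k)%N ->
        (c%:E <= sup_modulus U lambda (fine (critical_exponent U lambda)) k L)%E.
Proof.
move=> kappa1 b1 lambda32 L2 K1.
have b01 := invb_itv b1.
have [l _ hl] : exists2 l, (0 < l)%N & 4 * lambda * b^-1 ^+ l < 1.
  by apply: small_exprn => //; lra.
have [j j0 hj] : exists2 j, (0 < j)%N & 2 * (L + 3) * b^-1 ^+ j < 1.
  by apply: small_exprn => //; lra.
have three0 : 0 < (3 : R) by lra.
have [D0 D01 cD0] := cells_card 0 kappa1 b1 K1 three0.
have [Dj Dj1 cDj] := cells_card j kappa1 b1 K1 three0.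
have [Dl Dl1 cDl] := cells_card l kappa1 b1 K1 three0.
pose D := D0 + Dj + Dl.
have D1 : 1 <= D by rewrite /D; lra.
have Dgt0 : 0 < D by lra.
(* For [w = 2 * lambda * b^-k1] this says [D^2 * w < 1/2]. At exponent [M] the quantity to bound is
   [D * N1 * (D^2 * w)^M], and [M] is chosen afterwards to absorb [D * N1]. *)
have [k1 _ hk1] : exists2 k, (0 < k)%N & 4 * lambda * (D * D) * b^-1 ^+ k < 1.
  by apply: small_exprn => //; rewrite !mulr_ge0//; lra.
have mu0 : 0 < L + 2 * lambda by lra.
have [N1 N11 cN1] := cells_card k1 kappa1 b1 K1 mu0.
have [M M0 hM] : exists2 M, (0 < M)%N & D * N1 * 2^-1 ^+ M < 1.
  by apply: small_exprn; [lra|rewrite mulr_ge0//; lra].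
pose P0 : R := M%:R.
have P00 : 0 < P0 by rewrite ltr0n.
pose A p := D * (D `^ p * D `^ p).
have A0 p : 0 < A p by rewrite !mulr_gt0 ?powR_gt0.
(* Of the 6, a factor 3 is lost when lowering the exponent and a factor 2 leaves the product at most
   [1/2]. *)
exists (6 * A P0)^-1; first by rewrite invr_gt0 mulr_gt0.
move=> X U X0 _ dbl _ crit0 k _.
have bound0 : cells_bound U 3 0 D.
  by move=> n N x n0 EN; apply: le_trans (cD0 X U dbl n N x n0 EN) _; rewrite /D; lra.
have boundj : cells_bound U 3 j D.
  by move=> n N x n0 EN; apply: le_trans (cDj X U dbl n N x n0 EN) _; rewrite /D; lra.
have boundl : cells_bound U 3 l D.
  by move=> n N x n0 EN; apply: le_trans (cDl X U dbl n N x n0 EN) _; rewrite /D; lra.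
have crit_le p k' theta : 0 < p -> 0 <= theta ->
    crossing_weights U lambda L p k' theta -> A p * theta < 1 ->
    (critical_exponent U lambda <= p%:E)%E.
  move=> p0 th0 cross small.
  by apply: (critical_exponent_le (D := D) (l := l) (j := j)) cross small => //; lra.
have crit_fin : (critical_exponent U lambda <= P0%:E)%E.
  have w0 : 0 <= b^-1 ^+ k1 by have /andP[] := exprV_le1 k1 b1.
  have W0 : 0 <= 2 * lambda * b^-1 ^+ k1 by rewrite !mulr_ge0//; lra.
  apply: (@crit_le P0 k1 (N1 * (2 * lambda * b^-1 ^+ k1) `^ P0)) => //.
  - by rewrite mulr_ge0 ?powR_ge0//; lra.
  - exact: uniform_weights (cN1 X U dbl).
  rewrite /A /P0 !powR_mulrn ?(ltW Dgt0)//.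
  have -> : D * (D ^+ M * D ^+ M) * (N1 * (2 * lambda * b^-1 ^+ k1) ^+ M) =
    D * N1 * (D * D * (2 * lambda * b^-1 ^+ k1)) ^+ M by rewrite !exprMn; ring.
  have DN0 : 0 <= D * N1 by rewrite mulr_ge0//; lra.
  apply: le_lt_trans hM; rewrite ler_wpM2l// lerXn2r ?nnegrE ?mulr_ge0 ?(ltW Dgt0)//.
    by lra.
  by lra.
have critE : (fine (critical_exponent U lambda))%:E = critical_exponent U lambda.
  by rewrite fineK// fin_numE gt_eqF ?lt_eqF//;
    [exact: le_lt_trans crit_fin (ltry _)|exact: lt_trans (ltNyr _) crit0].
set Q := fine _ in critE *.
move: crit0 crit_fin; rewrite -critE lte_fin lee_fin => Q0 QP.
rewrite leNgt; apply/negP => sup_small.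
have c0 : 0 < (6 * A P0)^-1 by rewrite invr_gt0 mulr_gt0.
(* This [N] depends on [k], but it only affects how close [p] is to [Q]. *)
have [N N_1 cN] := cells_card k kappa1 b1 K1 mu0.
have [p /andP[p0 pQ] cross] :=
  crossing_weights_perturb kappa1 b1 lambda32 L2 Q0 c0 N_1 (cN X U dbl) sup_small.
have : (critical_exponent U lambda <= p%:E)%E.
  apply: crit_le cross _ => //; first by rewrite mulr_ge0// ltW.
  (* [A] is nondecreasing because [1 <= D], and [p < Q <= P0]. *)
  have : A p <= A P0.
    rewrite ler_wpM2l ?(ltW Dgt0)// ler_pM ?powR_ge0// ler_powR//; lra.
  move: (A p) (A P0) (A0 P0) => x y y0 xy.
  have -> : x * (3 * (6 * y)^-1) = x / (2 * y) by field; rewrite gt_eqF.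
  by rewrite ltr_pdivrMr ?mulr_gt0//; lra.
by rewrite -critE lee_fin leNgt pQ.
Qed.
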